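(* Let $q=p^n\ge3$ with $p$ prime, let $r\in\mathbb{F}_q^*$ and $b=r^{p-1}$ (an $\frac{p^n-1}{p-1}$-th root of unity). Let $V[x]$ be the $\mathbb{F}_q$-vector space of polynomials $f\in\mathbb{F}_q[x]$ of degree at most $q-2$ with $f(0)=0$, and let $A_r:V[x]\to V[x]$ be the linear map $A_r(f)(x)=f(x+r)-f(r)$. Then the eigenspace $\ker(A_r-I)$ is spanned by the monomials $x,x^p,x^{p^2},\ldots,x^{p^{n-1}}$ and the polynomials $(x^p-bx)^i$ for $i=2,\ldots,p^{n-1}-1$ with $i$ not a power of $p$.
   Context: Polynomials in $V[x]$ are formal polynomials; $f(x+r)$ denotes formal substitution; $I$ is the identity map of $V[x]$. *)

(* Defs.v *)
From HB Require Import structures.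
From mathcomp Require Import all_boot all_order all_algebra all_field.

Set Implicit Arguments.
Unset Strict Implicit.
Unset Printing Implicit Defensive.

Import GRing.Theory.
Local Open Scope ring_scope.

Section VSpace.
Variables (F : fieldType) (q : nat).

(* [size f <= q.-1] means that f has degree at most q - 2 (or is 0), for q >= 2. *)
Definition eval0 (f : {poly_(q.-1) F}) : F^o := (f : {poly F}).[0].

Lemma eval0_is_linear : linear eval0.
Proof. by move=> a f g; rewrite /eval0 /= hornerD hornerZ. Qed.

HB.instance Definition _ :=
  GRing.isLinear.Build F {poly_(q.-1) F} F^o _ eval0 eval0_is_linear.

Definition Vx_space : {vspace {poly_(q.-1) F}} := lker (linfun eval0).

Definition Vx := subvs_of Vx_space.

HB.instance Definition _ := Vector.on Vx.

Definition Vx_poly (f : Vx) : {poly F} := polyn (vsval f).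

Lemma mem_Vx_space (f : {poly_(q.-1) F}) :
  (f \in Vx_space) = ((f : {poly F}).[0] == 0).
Proof. by rewrite memv_ker lfunE. Qed.

Lemma Vx_poly_inj : injective Vx_poly.
Proof. by move=> f g /val_inj/val_inj. Qed.

Lemma Vx_polyP (g : {poly F}) :
  (exists f : Vx, Vx_poly f = g) <-> (size g <= q.-1)%N /\ g.[0] = 0.
Proof.
split=> [[f <-]|[sg g0]].
  split; first exact: size_npoly.
  by apply/eqP; rewrite -mem_Vx_space; apply: subvsP.
have gV : NPoly (sg : g \is a poly_of_size _) \in Vx_space.
  by rewrite mem_Vx_space /= g0.
by exists (Subvs gV).
Qed.

Section Shift.
Variable r : F.

Definition shift_poly (f : {poly F}) : {poly F} :=
  f \Po ('X + r%:P) - f.[r]%:P.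

Lemma size_shift_poly (f : Vx) :
  shift_poly (Vx_poly f) \is a poly_of_size q.-1.
Proof.
have sf : (size (Vx_poly f) <= q.-1)%N by exact: size_npoly.
rewrite qualifE /= /shift_poly.
have [->|f0] := eqVneq (Vx_poly f) 0.
  by rewrite comp_poly0 horner0 subr0 size_poly0.
apply: leq_trans (size_polyD _ _) _.
rewrite geq_max size_polyN size_comp_poly2 ?size_XaddC // sf /=.
apply: leq_trans (size_polyC_leq1 _) (leq_trans _ sf).
by rewrite size_poly_gt0.
Qed.

Lemma shift_poly_mem (f : Vx) : NPoly (size_shift_poly f) \in Vx_space.
Proof.
rewrite mem_Vx_space /= /shift_poly hornerD hornerN horner_comp !hornerE.
by rewrite subrr.
Qed.

Definition A_fun (f : Vx) : Vx := Subvs (shift_poly_mem f).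

Lemma A_fun_is_linear : linear A_fun.
Proof.
move=> a f g; apply: Vx_poly_inj; rewrite /Vx_poly /= /shift_poly.
rewrite comp_polyD comp_polyZ hornerD hornerZ polyCD polyCM.
by rewrite scalerBr -mul_polyC -[in RHS](mul_polyC _ (_%:P)) opprD addrACA.
Qed.

HB.instance Definition _ := GRing.isLinear.Build F Vx Vx _ A_fun A_fun_is_linear.

Definition A_map : 'End(Vx) := linfun A_fun.

Lemma A_mapE (f : Vx) :
  Vx_poly (A_map f) = Vx_poly f \Po ('X + r%:P) - (Vx_poly f).[r]%:P.
Proof. by rewrite lfunE. Qed.

End Shift.
End VSpace.

(* For p > 1, an exponent k with i = p ^ k satisfies k < i (see [is_powerP]). *)
Definition is_power (p i : nat) : bool := [exists k : 'I_i, i == (p ^ k)%N].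

Lemma is_powerP (p i : nat) : (1 < p)%N ->
  reflect (exists k, i = (p ^ k)%N) (is_power p i).
Proof.
move=> p1; apply: (iffP existsP) => [[k /eqP ->]|[k ik]]; first by exists k.
have ki : (k < i)%N by rewrite ik ltn_expl.
by exists (Ordinal ki); apply/eqP.
Qed.

Section Generators.
Variables (F : fieldType) (p n : nat) (b : F).

Definition p_monomials : seq {poly F} := [seq 'X^(p ^ j) | j <- iota 0 n].

Definition p_binomial_powers : seq {poly F} :=
  [seq ('X^p - b *: 'X) ^+ i | i <- index_iota 2 (p ^ n.-1) & ~~ is_power p i].

End Generators.

(* Main.v *)
Require Import Defs.
From HB Require Import structures.
From mathcomp Require Import all_boot all_order all_algebra all_field.

(** If [f (x + r) - f r = f x], then [f - (f r / r) x] is invariant under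
    [x -> x + r]. Dividing an [r]-periodic polynomial by [g = x^p - r^(p-1) x],
    itself [r]-periodic, leaves an [r]-periodic remainder of degree less than
    [p], which takes its value at [0] at the [p] points [k r] and so is constant.
    Hence [r]-periodic polynomials are the polynomials in [g], and
    [g^(p^k)] is a combination of [x^(p^k)] and [x^(p^(k+1))]. *)

Import GRing.Theory.
Local Open Scope ring_scope.

Section PeriodicPolynomials.
Variables (F : fieldType) (p : nat) (r : F).
Hypotheses (pcharFp : p \in [pchar F]) (r_neq0 : r != 0).

Let p_prime : prime p := pcharf_prime pcharFp.
Let p_gt1 : (1 < p)%N := prime_gt1 p_prime.

Local Notation g := ('X^p - (r ^+ (p - 1)) *: 'X : {poly F}).

Lemma pchar_poly_pnat k : [pchar {poly F}].-nat (p ^ k)%N.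
Proof.
rewrite (eq_pnat _ (pchar_poly F)).
by rewrite pnatX (eq_pnat _ (pcharf_eq pcharFp)) pnat_id.
Qed.

Lemma comp_Xn_pchar_shift k :
  'X^(p ^ k) \Po ('X + r%:P) = 'X^(p ^ k) + (r ^+ (p ^ k))%:P :> {poly F}.
Proof. by rewrite comp_Xn_poly exprDn_pchar ?pchar_poly_pnat // -polyC_exp. Qed.

Lemma binomial_periodic : g \Po ('X + r%:P) = g.
Proof.
rewrite comp_polyB comp_polyZ comp_polyX.
have -> : 'X^p = 'X^(p ^ 1) :> {poly F} by rewrite expn1.
rewrite comp_Xn_pchar_shift expn1 scalerDr -[_ *: r%:P]mul_polyC -polyCM -exprSr.
by rewrite subn1 prednK ?prime_gt0 // opprD addrACA subrr addr0.
Qed.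

Lemma size_binomial : size g = p.+1.
Proof.
rewrite size_polyDl size_polyXn // size_polyN.
by rewrite (leq_ltn_trans (size_scale_leq _ _)) // size_polyX.
Qed.

(** Raising to the power [p ^ k] is additive in characteristic [p], sign included. This handles the
    powers of [g] that are left out of [p_binomial_powers]. *)
Lemma binomial_expp k :
  g ^+ (p ^ k) = 'X^(p ^ k.+1) - (r ^+ (p - 1)) ^+ (p ^ k) *: 'X^(p ^ k).
Proof.
have pk := pchar_poly_pnat k.
by rewrite exprDn_pchar // exprNn_pchar // exprZn
  -['X^p ^+ _]exprM -expnS.
Qed.

Lemma periodic_small_const (f : {poly F}) : f \Po ('X + r%:P) = f ->
  (size f <= p)%N -> f = (f.[0])%:P.
Proof.
move=> fr sf; apply/eqP; rewrite -subr_eq0; apply/negPn/negP => nz.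
have froot k : f.[r *+ k] = f.[0].
  elim: k => [|k IHk]; first by rewrite mulr0n.
  by rewrite -IHk -[in RHS]fr horner_comp !hornerE mulrSr.
pose rs := [seq r *+ k | k <- iota 0 p].
have /(_ rs) := max_poly_roots nz.
have -> : all (root (f - f.[0]%:P)) rs.
  by apply/allP => _ /mapP[k _ ->]; rewrite /root !hornerE froot subrr.
(* If two entries agree, then [r *+ (j - i) = 0], so [p] divides [j - i < p]. *)
have -> : uniq rs.
  rewrite map_inj_in_uniq ?iota_uniq // => i j; rewrite !mem_iota /= add0n.
  wlog ij : i j / (i <= j)%N => [hw ip jp e|ip jp e].
    by case: (leqP i j) => [|/ltnW] le; [apply: hw | apply/esym/hw].
  have : r *+ (j - i) = 0 by rewrite mulrnBr // e subrr.
  rewrite -mulr_natr => /eqP; rewrite mulf_eq0 (negPf r_neq0) /=.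
  rewrite -(dvdn_pcharf pcharFp) => /dvdn_leq.
  case: (posnP (j - i)) => [/eqP|_ /(_ isT)].
    by rewrite subn_eq0 => ji _; apply/eqP; rewrite eqn_leq ij ji.
  by rewrite leqNgt (leq_ltn_trans (leq_subr _ _) jp).
rewrite size_map size_iota => /(_ isT isT); rewrite ltnNge => /negP; apply.
rewrite (leq_trans (size_polyD _ _)) // size_polyN geq_max sf /=.
exact: leq_trans (size_polyC_leq1 _) (ltnW p_gt1).
Qed.

(** Strong induction on the size: uniqueness of Euclidean division makes the quotient by [g]
    periodic too, hence itself a polynomial in [g]. *)
Lemma periodic_comp_binomial (f : {poly F}) : f \Po ('X + r%:P) = f ->
  exists h : {poly F}, f = h \Po g.
Proof.
have [m] := ubnP (size f); elim: m f => // m IHm f /ltnSE sf fr.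
have [sf1|sf1] := leqP (size f) 1.
  by exists f; rewrite (size1_polyC sf1) comp_polyC.
have g0 : g != 0 by rewrite -size_poly_eq0 size_binomial.
have fE := divp_eq f g.
(* Shifting the division identity gives a second division of [f] by [g]. The shift preserves sizes,
   so the two quotients agree and so do the two remainders. *)
have fE' : f = (f %/ g \Po ('X + r%:P)) * g + (f %% g \Po ('X + r%:P)).
  by rewrite -{2}binomial_periodic -comp_polyM -comp_polyD -fE fr.
have ssh : (size ((f %% g) \Po ('X + r%:P)%R) < size g)%N.
  by rewrite size_comp_poly2 ?size_XaddC // ltn_modp.
have mr : (f %% g) \Po ('X + r%:P) = f %% g.
  by rewrite [X in _ = X %% _]fE' modpD modp_mull add0r [RHS]modp_small.
have dr : (f %/ g) \Po ('X + r%:P) = f %/ g.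
  apply: (mulIf g0); apply: (addIr (f %% g)).
  by rewrite -fE [in RHS]fE' mr.
have mC : f %% g = ((f %% g).[0])%:P.
  by apply: periodic_small_const mr _; rewrite -ltnS -size_binomial ltn_modp.
have [|h hE] := IHm (f %/ g) _ dr.
  apply: leq_trans sf; rewrite size_divp // size_binomial /=.
  by rewrite ltn_subrL prime_gt0 // (ltnW sf1).
exists (h * 'X + ((f %% g).[0])%:P).
by rewrite comp_polyD comp_polyM comp_polyX comp_polyC -hE -mC -fE.
Qed.

End PeriodicPolynomials.

Lemma Vx_poly_map_surj (F : fieldType) (q : nat) (s : seq {poly F}) :
  (forall f, f \in s -> (size f <= q.-1)%N /\ f.[0] = 0) ->
  exists gens : seq (Vx F q), map (@Vx_poly F q) gens = s.
Proof.
elim: s => [|f s IHs] sP; first by exists [::].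
have [|gens <-] := IHs; first by move=> h hs; apply: sP; rewrite inE hs orbT.
have /Vx_polyP[v <-] := sP f (mem_head _ _).
by exists (v :: gens).
Qed.

Lemma mem_ker_A_map (F : fieldType) (q : nat) (r : F) (f : Vx F q) :
  (f \in lker (A_map q r - \1%VF)) =
  (Vx_poly f \Po ('X + r%:P) == Vx_poly f + (Vx_poly f).[r]%:P).
Proof.
rewrite memv_ker add_lfunE opp_lfunE id_lfunE subr_eq0.
by rewrite -(inj_eq (@Vx_poly_inj F q)) A_mapE subr_eq.
Qed.

(** This makes the largest monomial fit: ['X^(p ^ n.-1)] has size [p ^ n.-1 + 1], to be at most
    [p ^ n - 1]. The bound fails for [p ^ n = 2]. *)
Lemma expp_pred_add2_le p n : prime p -> (3 <= p ^ n)%N ->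
  (0 < n)%N /\ (p ^ n.-1 + 2 <= p ^ n)%N.
Proof.
move=> p_prime; have p_gt1 := prime_gt1 p_prime.
case: n => // n; rewrite expnS /= => q3; split=> //.
have [p2|p_gt2] := eqVneq p 2%N.
  case: n q3 => [|n _]; first by rewrite p2.
  by rewrite {2}p2 mul2n -addnn leq_add2l expnS p2 leq_pmulr // expn_gt0.
have {}p_gt2 : (2 < p)%N by rewrite ltn_neqAle eq_sym p_gt2.
apply: leq_trans (leq_mul p_gt2 (leqnn _)).
by rewrite mulSn leq_add2l leq_pmulr // expn_gt0 (ltnW p_gt1).
Qed.

Theorem theorem2 (p n : nat) (F : finFieldType) (r : F)
    (p_prime : prime p) (q_ge3 : (3 <= p ^ n)%N) (cardF : #|F| = (p ^ n)%N)
    (r_neq0 : r != 0) :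
  let b : F := r ^+ (p - 1) in
  ((p ^ n - 1) %/ (p - 1))%N.-unity_root b /\
  exists gens : seq (Vx F (p ^ n)),
    map (@Vx_poly F (p ^ n)) gens
      = p_monomials F p n ++ p_binomial_powers p n b /\
    lker (A_map (p ^ n) r - \1%VF) = <<gens>>%VS.
Proof.
have p_gt1 := prime_gt1 p_prime; have p_gt0 := ltnW p_gt1.
have pcharFp : p \in [pchar F] := card_finPcharP cardF p_prime.
have [n_gt0 szq] := expp_pred_add2_le _ _ p_prime q_ge3.
have q_gt0 : (0 < p ^ n)%N by rewrite expn_gt0 p_gt0.
move=> b; split.
  (* The power of [b] is [r ^+ (p ^ n - 1)]; multiplying by [r] reduces the claim to
     [r ^+ #|F| = r]. *)
  rewrite unity_rootE /b -exprM mulnC divnK; last first.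
    by rewrite !subn1 predn_exp dvdn_mulr.
  apply/eqP/(mulfI r_neq0); rewrite mulr1 -exprS subn1 prednK //.
  by rewrite -cardF expf_card.
set g : {poly F} := 'X^p - b *: 'X.
have g0 : g.[0] = 0 by rewrite !hornerE expr0n eqn0Ngt p_gt0 ?subrr.
have gr : g \Po ('X + r%:P) = g by exact: binomial_periodic.
have sg : size g = p.+1 by exact: size_binomial.
have [|gens gensE] :=
    @Vx_poly_map_surj F (p ^ n) (p_monomials F p n ++ p_binomial_powers p n b).
  move=> f; rewrite mem_cat => /orP[] /mapP[i].
    rewrite mem_iota add0n => /andP[_ ltin] ->; rewrite size_polyXn hornerXn.
    rewrite expr0n expn_eq0 eqn0Ngt p_gt0; split=> //.
    rewrite -ltnS prednK //; apply: leq_trans szq.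
    by rewrite addn2 !ltnS leq_pexp2l // -ltnS prednK.
  rewrite mem_filter mem_index_iota => /and3P[_ i2 ltin] ->.
  rewrite horner_exp g0 expr0n eqn0Ngt (ltnW i2); split=> //.
  apply: leq_trans (size_poly_exp_leq _ _) _; rewrite sg /=.
  rewrite -ltnS prednK //.
  (* The size of [g ^+ i] is at most [p * i + 1], and [i < p ^ n.-1] gives [p * i.+1 <= p ^ n]. *)
  have /leq_trans-> // : ((p * i).+2 <= p * i.+1)%N by rewrite mulnS -add2n leq_add2r.
  by rewrite -[n in (p ^ n)%N]prednK // expnS leq_mul2l ltin orbT.
exists gens; split=> //; apply/eqP; rewrite eqEsubv; apply/andP; split; last first.
  apply/span_subvP => v /(map_f (@Vx_poly F (p ^ n))); rewrite gensE mem_ker_A_map.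
  rewrite mem_cat => /orP[] /mapP[i].
    by move=> _ ->; rewrite (comp_Xn_pchar_shift _ _ _ pcharFp) hornerXn.
  rewrite mem_filter mem_index_iota => /and3P[_ i2 _] ->.
  (* Periodicity carries the root [0] of [g] to [r], so the constant to be added for [g ^+ i]
     vanishes. *)
  have gr0 : g.[r] = 0 by rewrite -g0 -[in RHS]gr horner_comp !hornerE.
  by rewrite horner_exp gr0 expr0n eqn0Ngt (ltnW i2) addr0 rmorphXn /= gr.
apply/subvP => f; rewrite mem_ker_A_map => /eqP fr.
(* [P] transports membership in the span to plain polynomials, where products and compositions are
   available. *)
pose P (u : {poly F}) := exists2 v, v \in <<gens>>%VS & Vx_poly v = u.
suff [v vP /Vx_poly_inj <-] : P (Vx_poly f) by [].
have PD u w : P u -> P w -> P (u + w).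
  by move=> [v vP <-] [v' vP' <-]; exists (v + v'); rewrite ?memvD.
have PZ c u : P u -> P (c *: u).
  by move=> [v vP <-]; exists (c *: v); rewrite ?memvZ.
have P0 : P 0 by exists 0; rewrite ?mem0v.
have Pgen u : u \in p_monomials F p n ++ p_binomial_powers p n b -> P u.
  by rewrite -gensE => /mapP[v vP ->]; exists v => //; apply: memv_span.
have PX k : (k < n)%N -> P 'X^(p ^ k).
  move=> kn; apply: Pgen; rewrite mem_cat; apply/orP; left.
  by apply: (map_f (fun j => 'X^(p ^ j))); rewrite mem_iota.
(* For [i = p ^ k] the bound on [i] forces [k.+1 < n], so both monomials of [binomial_expp] are
   generators; this includes [i = 1]. *)
have Pg i : (0 < i < p ^ n.-1)%N -> P (g ^+ i).
  case/andP=> i0 ilt; have [/(is_powerP _ p_gt1)[k ik]|Ni] := boolP (is_power p i).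
    have kn : (k.+1 < n)%N.
      by rewrite -[n]prednK // ltnS -(ltn_exp2l _ _ p_gt1) -ik.
    rewrite ik binomial_expp // -scaleNr.
    by apply: PD; [|apply: PZ]; apply: PX => //; apply: ltnW.
  apply: Pgen; rewrite mem_cat; apply/orP; right; apply: (map_f (fun i => g ^+ i)).
  rewrite mem_filter Ni mem_index_iota ilt andbT ltn_neqAle i0 andbT.
  by apply: contra Ni => /eqP <-; apply/(is_powerP _ p_gt1); exists 0%N.
set u := Vx_poly f in fr *.
have [su u0] : (size u <= (p ^ n).-1)%N /\ u.[0] = 0 by apply/Vx_polyP; exists f.
set c := u.[r] / r; pose w := u - c *: 'X.
have wr : w \Po ('X + r%:P) = w.
  rewrite comp_polyB comp_polyZ comp_polyX fr scalerDr -[c *: r%:P]mul_polyC.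
  by rewrite -polyCM divfK // opprD addrACA subrr addr0.
have [h hE] := periodic_comp_binomial _ _ _ pcharFp r_neq0 _ wr.
(* Composition multiplies degrees, so [p] times the degree of [h] is the degree of [w], which is
   below [p ^ n]. *)
have sh : (size h <= p ^ n.-1)%N.
  have sw : (size w <= (p ^ n).-1)%N.
    rewrite (leq_trans (size_polyD _ _)) // size_polyN geq_max su.
    by rewrite (leq_trans (size_scale_leq _ _)) // size_polyX -ltnS prednK.
  have := size_comp_poly h g; rewrite -[h \Po g]hE sg /= => e.
  have : ((size h).-1 * p < p ^ n.-1 * p)%N.
    rewrite -e -expnSr (prednK n_gt0) //; apply: leq_ltn_trans (leq_pred _) _.
    by rewrite -[X in (_ < X)%N]prednK.
  by rewrite ltn_pmul2r //; apply: leq_trans (leqSpred _).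
(* The term [g ^+ 0 = 1] lies outside the range of [Pg], so its coefficient must vanish; it is
   [w.[0]] because [g.[0] = 0]. *)
have h0 : h`_0 = 0.
  have : w.[0] = 0 by rewrite hornerD hornerN hornerZ hornerX u0 mulr0 subr0.
  by rewrite hE horner_comp g0 horner_coef0.
have -> : u = w + c *: 'X by rewrite subrK.
apply: (PD w); last by apply: PZ; have := PX 0%N n_gt0; rewrite expn0.
rewrite hE comp_polyE; apply: (big_ind P P0 PD) => i _.
case: (posnP i) => [->|i0]; first by rewrite h0 scale0r.
by apply: PZ; apply: Pg; rewrite i0 (leq_trans (ltn_ord i)).
Qed.
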